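(* There exist positive constants $c_0$, $c_1$ and $C_8$ such that, for all $y\in B$, $$P_y(\tau<\infty)\le h^{a,0}(y)\le C_8\,P_y(\tau<\infty),\qquad\text{where } h^{a,0}=c_0{\bm h}_r+c_1h_{\rho_1}.$$ In particular, $h^{a,0}(y)$ approximates $P_y(\tau<\infty)$ with bounded relative error (i.e. $|h^{a,0}(y)-P_y(\tau<\infty)|/P_y(\tau<\infty)$ is bounded over $y\in B$).
   Context: Parameters: $\lambda_1,\lambda_2,\mu_1,\mu_2>0$ with $\lambda_1+\lambda_2+\mu_1+\mu_2=1$; $\rho_i=\lambda_i/\mu_i$, $r=(\lambda_1+\lambda_2)/(\mu_1+\mu_2)$. Standing assumptions: $\rho_1,\rho_2<1$, $\rho_2\le r\le\rho_1$, $\rho_1\ne\rho_2$, $r^2/\rho_2<1$. $Y$ is the random walk on $\mathbb{Z}\times\mathbb{Z}_+$ with i.i.d. increments $J_k$, $P(J_k=(-1,0))=\lambda_1$, $P(J_k=(1,0))=\mu_1$, $P(J_k=(0,1))=\lambda_2$, $P(J_k=(0,-1))=\mu_2$: it moves by the next increment if this keeps it in $\mathbb{Z}\times\mathbb{Z}_+$, and otherwise does not move. $B=\{y\in\mathbb{Z}\times\mathbb{Z}_+: y(1)\ge y(2)\}$, $\partial B=\{y\in\mathbb{Z}\times\mathbb{Z}_+:y(1)=y(2)\}$, $\tau=\inf\{k\ge0:Y_k\in\partial B\}$, and $P_y$ is the law of $Y$ started at $y$. ${\bm h}_r(y)=r^{y(1)-y(2)}-\frac{1-r}{1-\rho_2/r}\,r^{y(1)-y(2)}\left(\frac{r^2}{\rho_2}\right)^{y(2)}$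 and $h_{\rho_1}(y)=\rho_1^{y(1)}$. *)

(* Defs.v *)
From HB Require Import structures.
From mathcomp Require Import all_boot all_order all_algebra.
From mathcomp Require Import finmap.
From mathcomp Require Import all_classical all_reals all_analysis.

Set Implicit Arguments.
Unset Strict Implicit.
Unset Printing Implicit Defensive.

Import Order.TTheory GRing.Theory Num.Theory.

Local Open Scope classical_set_scope.
Local Open Scope ring_scope.

(* Points of Z x Z; the state space Z x Z_+ is cut out by [upper_half]. *)
Definition upper_half : set (int * int) := [set y | 0 <= y.2].

Definition B : set (int * int) := upper_half `&` [set y | y.2 <= y.1].

Definition bdB : set (int * int) := upper_half `&` [set y | y.1 = y.2].

Definition step (y j : int * int) : int * int :=
  if 0 <= (y + j).2 then y + j else y.

(* [J k] is the increment used between times k and k+1. *)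
Fixpoint walk (J : nat -> int * int) (y : int * int) (n : nat) : int * int :=
  if n is k.+1 then step (walk J y k) (J k) else y.

Section Probability.
Variables (R : realType) (d : measure_display) (T : measurableType d).
Variable P : probability T R.

(* Z x Z is countable and carries its full power set as sigma-algebra, so
   measurability and independence range over arbitrary sets of values. *)
Definition measurable_increments (J : nat -> T -> int * int) : Prop :=
  forall (k : nat) (A : set (int * int)), measurable (J k @^-1` A).

Definition independent_increments (J : nat -> T -> int * int) : Prop :=
  forall (F : {fset nat}) (A : nat -> set (int * int)),
    P (\bigcap_(k in [set` F]) (J k @^-1` A k))
    = (\prod_(k <- F) P (J k @^-1` A k))%E.

(* The four probabilities sum to 1 in the intended use, so they determine the
   common distribution of the increments. *)
Definition increment_law (l1 l2 m1 m2 : R) (X : T -> int * int) : Prop :=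
  [/\ P (X @^-1` [set (-1, 0)]) = l1%:E,
      P (X @^-1` [set (1, 0)]) = m1%:E,
      P (X @^-1` [set (0, 1)]) = l2%:E &
      P (X @^-1` [set (0, -1)]) = m2%:E].

Definition iid_increments (l1 l2 m1 m2 : R) (J : nat -> T -> int * int) : Prop :=
  [/\ measurable_increments J,
      independent_increments J &
      forall k, increment_law l1 l2 m1 m2 (J k)].

(* Infimum in the extended reals: [+oo] when the walk never meets [bdB]. *)
Definition tau (J : nat -> T -> int * int) (y : int * int) (w : T) : \bar R :=
  ereal_inf [set (k%:R)%:E | k in [set k | bdB (walk (J ^~ w) y k)]].

Definition hit_prob (J : nat -> T -> int * int) (y : int * int) : R :=
  fine (P [set w | (tau J y w < +oo)%E]).

End Probability.

Definition h_r (R : realType) (r rho2 : R) (y : int * int) : R :=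
  r ^ (y.1 - y.2)
  - (1 - r) / (1 - rho2 / r) * r ^ (y.1 - y.2) * (r ^+ 2 / rho2) ^ y.2.

Definition h_rho1 (R : realType) (rho1 : R) (y : int * int) : R := rho1 ^ y.1.

(* Main.v *)
(* Both h_r and h_rho1 are harmonic for the walk, including on the axis y.2 = 0:
   this is what the coefficient in h_r achieves.  Since rho2 < r < rho1 < 1, for
   c1 large the function h = 2 h_r + c1 h_rho1 is at least r ^ (y.1 - y.2) on B,
   hence positive there and at least 1 on the diagonal, so optional stopping gives
   P_y(tau <= n) <= h(y).  Conversely h is bounded on B by some M and dominated by
   a multiple of g(y) = s ^ (y.1 - y.2) + K s ^ y.1, with s in (rho1, 1), which one
   step of the walk contracts by a factor k < 1; so h(y) <= M P_y(tau <= n) +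
   O(k ^ n) and h(y) <= M P_y(tau < oo). *)
Require Import Defs.
From HB Require Import structures.
From mathcomp Require Import all_boot all_order all_algebra.
From mathcomp Require Import finmap.
From mathcomp Require Import all_classical all_reals all_analysis.
From mathcomp Require Import ring lra zify.

Import Order.TTheory GRing.Theory Num.Theory.
Import numFieldNormedType.Exports.

Local Open Scope classical_set_scope.
Local Open Scope ring_scope.

(** * One-step operator and hitting within finitely many steps *)

Definition transition {R : realType} (l1 l2 m1 m2 : R)
    (f : int * int -> R) (y : int * int) : R :=
  l1 * f (step y (-1, 0)) + m1 * f (step y (1, 0)) +
  l2 * f (step y (0, 1)) + m2 * f (step y (0, -1)).

(** This is [P_y(tau <= n)] given by its first-step recursion; it lets all estimates be done by
    induction before any probability space enters. *)
Fixpoint hit_within {R : realType} (l1 l2 m1 m2 : R) (n : nat) (y : int * int) : R :=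
  if (0 <= y.2) && (y.1 == y.2) then 1 else
  if n is k.+1 then transition l1 l2 m1 m2 (hit_within l1 l2 m1 m2 k) y else 0.

Lemma bdBP y : reflect (bdB y) ((0 <= y.2) && (y.1 == y.2)).
Proof.
apply: (iffP andP) => [[h /eqP e]|[h e]]; first by split.
by split=> //; apply/eqP.
Qed.

Lemma hit_within_bdB {R : realType} (l1 l2 m1 m2 : R) n y :
  bdB y -> hit_within l1 l2 m1 m2 n y = 1.
Proof. by move/bdBP => h; case: n => [|n] /=; rewrite h. Qed.

Lemma hit_withinS {R : realType} (l1 l2 m1 m2 : R) n y : ~ bdB y ->
  hit_within l1 l2 m1 m2 n.+1 y =
  transition l1 l2 m1 m2 (hit_within l1 l2 m1 m2 n) y.
Proof. by move/bdBP/negbTE => /= ->. Qed.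

(** * Comparison on [B] under the transition operator *)

Section Transition.
Context {R : realType} (l1 l2 m1 m2 : R).
Hypotheses (l1_gt0 : 0 < l1) (l2_gt0 : 0 < l2) (m1_gt0 : 0 < m1) (m2_gt0 : 0 < m2).
Hypothesis sum1 : l1 + l2 + m1 + m2 = 1.

Local Notation T := (transition l1 l2 m1 m2).
Local Notation U := (hit_within l1 l2 m1 m2).

Lemma transitionD a b f g y :
  T (fun z => a * f z + b * g z) y = a * T f y + b * T g y.
Proof. by rewrite /transition; ring. Qed.

(** Off the diagonal [y.2 < y.1] holds between integers, so a single step cannot leave [B] and only
    values on [B] matter. *)
Lemma ler_transition_B f g y : B y -> ~ bdB y ->
  (forall z, B z -> f z <= g z) -> T f y <= T g y.
Proof.
move=> [y20 yB] ny fg.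
have {}ny : y.2 < y.1.
  by rewrite lt_neqAle yB andbT; apply/eqP => e; apply: ny; split.
rewrite /upper_half /= in y20 yB.
by rewrite /transition !lerD// ler_pM2l//; apply: fg; rewrite /B /upper_half /step;
  case: ifPn => /=; split => /=; lia.
Qed.

Definition geom (a b : R) (y : int * int) : R := a ^ y.1 * b ^ y.2.

(** A blocked downward step on the axis leaves the value unchanged, so its factor there is 1 instead
    of [b^-1]; elsewhere [geom a b] is an eigenfunction. *)
Lemma transition_geom a b y : a != 0 -> b != 0 -> 0 <= y.2 ->
  T (geom a b) y =
  (l1 / a + m1 * a + l2 * b + m2 * (if y.2 == 0 then 1 else b^-1)) * geom a b y.
Proof.
move=> a0 b0 y0; rewrite /transition /step /geom /=.
have -> : 0 <= y.2 + 0 by lia.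
have -> : 0 <= y.2 + 1 by lia.
have -> : (0 <= y.2 + -1) = (y.2 != 0) by lia.
case: (eqVneq y.2 0) => [e|_] /=;
  by rewrite !addr0 !expfzDr// ?expr1z ?exprN1; ring.
Qed.

(* Optional stopping at [min (tau, n)] for a nonnegative harmonic function. *)
Lemma hit_within_le (h : int * int -> R) n y :
  (forall z, B z -> T h z = h z) -> (forall z, B z -> 0 <= h z) ->
  (forall z, bdB z -> 1 <= h z) -> B y -> U n y <= h y.
Proof.
move=> hT h0 h1; elim: n y => [|n IH] y By.
  by rewrite /=; case: bdBP => [/h1//|_]; exact: h0.
have [/[dup] By' /h1|ny] := pselect (bdB y); first by rewrite hit_within_bdB.
by rewrite hit_withinS// -hT//; exact: ler_transition_B.
Qed.

(** Expand [h = T h] for [n] steps, stopping at the diagonal: stopped paths contribute at most [M]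
    each, and on the others the contraction of [g] leaves at most [D * k ^+ n * g y]. *)
Lemma le_hit_within (h g : int * int -> R) M D k n y : 0 <= M -> 0 <= D -> 0 <= k ->
  (forall z, B z -> T h z = h z) -> (forall z, B z -> h z <= M) ->
  (forall z, B z -> 0 <= g z) -> (forall z, B z -> T g z <= k * g z) ->
  (forall z, B z -> h z <= D * g z) ->
  B y -> h y <= M * U n y + D * k ^+ n * g y.
Proof.
move=> M0 D0 k0 hT hM g0 gT hg.
elim: n y => [|n IH] y By.
  by rewrite mulr1 (le_trans (hg _ By))// lerDr mulr_ge0//=; case: ifP.
have [/[dup] By' |ny] := pselect (bdB y).
  rewrite hit_within_bdB// mulr1 (le_trans (hM _ By))// lerDl.
  by rewrite !mulr_ge0 ?exprn_ge0 ?g0.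
rewrite hit_withinS// -hT//.
apply: le_trans (ler_transition_B _ _ _ By ny IH) _.
rewrite transitionD lerD2l exprSr mulrA -[leRHS]mulrA.
by rewrite ler_wpM2l ?mulr_ge0 ?exprn_ge0 ?gT.
Qed.

(** * Harmonicity of [h_rho1] and [h_r] *)

Local Notation rho1 := (l1 / m1).
Local Notation rho2 := (l2 / m2).
Local Notation r := ((l1 + l2) / (m1 + m2)).

Lemma transition_h_rho1 y : 0 <= y.2 -> T (h_rho1 rho1) y = h_rho1 rho1 y.
Proof.
move=> y0.
have E z : h_rho1 rho1 z = geom rho1 1 z by rewrite /geom exp1rz mulr1.
have -> : h_rho1 rho1 = geom rho1 1 by apply/funext.
have h : rho1 != 0 by rewrite gt_eqF// divr_gt0.
rewrite transition_geom ?oner_neq0// invr1 if_same -[RHS]mul1r; congr (_ * _).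
by rewrite -[RHS]sum1; field; rewrite !gt_eqF.
Qed.

Lemma h_rE (a b : R) y : a != 0 -> b != 0 ->
  h_r a b y = geom a a^-1 y - (1 - a) / (1 - b / a) * geom a (a / b) y.
Proof.
move=> a0 b0; rewrite /h_r /geom expfzDr// -invr_expz expfV; congr (_ - _).
have -> : a / b = a^-1 * (a ^+ 2 / b) by field; rewrite a0 b0.
by rewrite [in RHS]expfzMl; ring.
Qed.

Lemma geom_gt0 a b y : 0 < a -> 0 < b -> 0 < geom a b y.
Proof. by move=> a0 b0; rewrite mulr_gt0 ?exprz_gt0. Qed.

(** Here [m] is the distance to the diagonal and [n] the height; in these coordinates integer powers
    become natural ones. *)
Lemma B_diag y : B y -> exists m n : nat, y = (n%:Z + m%:Z, n%:Z).
Proof.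
case: y => y1 y2 [/= + yB]; rewrite /upper_half /= in yB *.
case: y2 yB => // n ny1 _; exists `|y1 - n%:Z|%N, n.
by congr (_, _); lia.
Qed.

Lemma geom_diag a b (m n : nat) :
  geom a b (n%:Z + m%:Z, n%:Z) = a ^+ m * (a * b) ^+ n.
Proof.
by rewrite /geom /= exprMn -PoszD -!exprnP exprD; ring.
Qed.

Hypotheses (rho21 : rho2 < rho1) (rho1_lt1 : rho1 < 1) (qr : r ^+ 2 / rho2 < 1).

(** [r] is the mediant of the fractions [rho1] and [rho2], hence strictly between them. *)
Lemma r_bounds : 0 < rho2 /\ rho2 < r /\ r < rho1.
Proof.
split; first by rewrite divr_gt0.
move: rho21; rewrite ltr_pdivrMr// mulrAC ltr_pdivlMr// => h.
split; rewrite ltr_pdivrMr ?addr_gt0// mulrAC ltr_pdivlMr//; rewrite ?addr_gt0 //; lra.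
Qed.

(** Both geometric terms have eigenvalue 1 above the axis. On the axis their defects are
    [m2 * (1 - r)] and [m2 * (1 - rho2 / r)], and the coefficient [c] makes them cancel. *)
Lemma transition_h_r y : 0 <= y.2 -> T (h_r r rho2) y = h_r r rho2 y.
Proof.
move=> y0; have [rho20 [rho2r rrho1]] := r_bounds.
have r0 : r != 0 by rewrite gt_eqF// (lt_trans rho20).
have rho20' : rho2 != 0 by rewrite gt_eqF.
have r2 : 1 - rho2 / r != 0.
  by rewrite gt_eqF// subr_gt0 ltr_pdivrMr ?mul1r// (lt_trans rho20).
set c := (1 - r) / (1 - rho2 / r).
have -> : h_r r rho2 = (fun z => 1 * geom r r^-1 z + (- c) * geom r (r / rho2) z).
  by apply/funext => z; rewrite h_rE// mul1r mulNr.
have rV0 : r^-1 != 0 by rewrite invr_eq0.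
have b0 : r / rho2 != 0 by rewrite mulf_neq0 ?invr_eq0.
rewrite transitionD !transition_geom//.
have e1 : l1 / r + m1 * r + l2 / r + m2 * r = 1.
  rewrite -[RHS]sum1; field; rewrite !gt_eqF ?addr_gt0//.
have e2 : l1 / r + m1 * r + l2 * (r / rho2) + m2 * (r / rho2)^-1 = 1.
  rewrite -[RHS]e1; field; rewrite !gt_eqF ?addr_gt0//.
have [yz|_] := eqVneq y.2 0; last by rewrite e2 invrK e1; ring.
have c' : c * (1 - rho2 / r) = 1 - r by rewrite /c mulfVK.
have e3 : l1 / r + m1 * r + l2 / r + m2 * 1 = 1 + m2 * (1 - r).
  transitivity (l1 / r + m1 * r + l2 / r + m2 * r + m2 * (1 - r)); first by ring.
  by rewrite e1.
have e4 : l1 / r + m1 * r + l2 * (r / rho2) + m2 * 1 = 1 + m2 * (1 - rho2 / r).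
  transitivity (l1 / r + m1 * r + l2 * (r / rho2) + m2 * (r / rho2)^-1 +
                m2 * (1 - (r / rho2)^-1)); first by ring.
  by rewrite e2 invf_div.
rewrite e3 e4 /geom yz !expr0z -c'; ring.
Qed.

(** * Bounds on the harmonic combination and the contracting majorant *)

Lemma exprn_small (q e : R) : 0 <= q -> q < 1 -> 0 < e -> exists N, q ^+ N <= e.
Proof.
move=> q0 q1 e0.
have : q ^+ n @[n --> \oo] --> (0 : R) by apply: cvg_expr; rewrite ger0_norm.
move=> /cvgrPdist_le/(_ _ e0)[N _ /(_ N (leqnn N))].
by rewrite sub0r normrN ger0_norm ?exprn_ge0//; exists N.
Qed.

Lemma geom_antidiag a (m n : nat) : a != 0 -> geom a a^-1 (n%:Z + m%:Z, n%:Z) = a ^+ m.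
Proof. by move=> a0; rewrite geom_diag divff// expr1n mulr1. Qed.

(** The lower bound yields positivity on [B] and values at least 1 on the diagonal; the upper one
    yields boundedness and domination by the contracting majorant. *)
Lemma h_bounds : exists2 c1, 0 < c1 & forall y, B y ->
  geom r r^-1 y <= 2 * h_r r rho2 y + c1 * h_rho1 rho1 y
    <= (2 + c1) * geom rho1 rho1^-1 y.
Proof.
have [rho20 [rho2r rrho1]] := r_bounds.
have r0 := lt_trans rho20 rho2r; have rho10 := lt_trans r0 rrho1.
have r1 := lt_trans rrho1 rho1_lt1.
pose q := r ^+ 2 / rho2; have q1 : q < 1 := qr.
have q0 : 0 < q by rewrite divr_gt0 ?exprn_gt0.
have [c cE c0] : exists2 c, c = (1 - r) / (1 - rho2 / r) & 0 < c.
  by eexists; first reflexivity; rewrite divr_gt0 ?subr_gt0// ltr_pdivrMr ?mul1r.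
have [N qN] : exists N, q ^+ N <= (2 * c)^-1.
  by apply: exprn_small; rewrite ?ltW// invr_gt0 mulr_gt0.
(* Chosen so that [c1 * rho1 ^+ n >= 2 * c] for all [n <= N]. *)
set c1 := 2 * c / rho1 ^+ N.
have c10 : 0 < c1 by rewrite divr_gt0 ?exprn_gt0// mulr_gt0.
exists c1 => // _ /B_diag[m [n ->]].
have -> : h_rho1 rho1 (n%:Z + m%:Z, n%:Z) = rho1 ^+ m * rho1 ^+ n.
  by rewrite /h_rho1 /= -PoszD -exprnP exprD mulrC.
rewrite h_rE ?gt_eqF// !geom_antidiag ?gt_eqF// geom_diag -cE.
have -> : r * (r / rho2) = q by rewrite mulrA.
have rm : r ^+ m <= rho1 ^+ m by rewrite lerXn2r ?nnegrE ?ltW.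
have rm0 : 0 < r ^+ m by rewrite exprn_gt0.
have rho1n : rho1 ^+ n <= 1 by rewrite exprn_ile1 ?ltW.
have rho1n0 : 0 < rho1 ^+ n by rewrite exprn_gt0.
have qn0 : 0 < q ^+ n by rewrite exprn_gt0.
apply/andP; split; last first.
  have := ltW (mulr_gt0 c0 (mulr_gt0 rm0 qn0)).
  have : c1 * (rho1 ^+ m * rho1 ^+ n) <= c1 * rho1 ^+ m.
    by rewrite ler_pM2l// ler_piMr// exprn_ge0 ?ltW.
  lra.
(* Since [rho1 ^+ m >= r ^+ m], factoring out [r ^+ m] reduces the lower bound to the height [n]
   alone. For [n <= N] the [c1] term offsets [2 * c * q ^+ n]; beyond [N], [c * q ^+ n <= 1/2]
   suffices. *)
have key : 1 <= 2 * (1 - c * q ^+ n) + c1 * rho1 ^+ n.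
  have [nN|Nn] := leqP n N.
    have : 2 * c <= c1 * rho1 ^+ n.
      rewrite /c1 mulrAC -mulrA ler_peMr ?mulr_ge0 ?(ltW c0)// ler_pdivlMr ?exprn_gt0// mul1r.
      by rewrite ler_wiXn2l // ltW.
    have : q ^+ n * c <= 1 * c by rewrite ler_wpM2r ?(ltW c0)// exprn_ile1// ltW.
    lra.
  have : q ^+ n <= (2 * c)^-1
    by apply: le_trans qN; rewrite ler_wiXn2l ?(ltW q0) ?(ltW q1) ?(ltnW Nn).
  rewrite -[_^-1]mul1r ler_pdivlMr ?mulr_gt0// => qc.
  have : 0 < c1 * rho1 ^+ n by rewrite mulr_gt0.
  lra.
apply: (@le_trans _ _ (r ^+ m * (2 * (1 - c * q ^+ n) + c1 * rho1 ^+ n))).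
  by rewrite ler_peMr// ltW.
have : c1 * rho1 ^+ n * r ^+ m <= c1 * rho1 ^+ n * rho1 ^+ m.
  by rewrite ler_pM2l// mulr_gt0.
lra.
Qed.

(* On the axis the pure geometric function of y.1 - y.2 may fail to contract,
   since the walk loses its downward moves there; a large multiple of s ^ y.1,
   which contracts everywhere, compensates. *)
Lemma contracting_majorant : exists s K k, [/\ rho1 < s, 0 < K, 0 <= k, k < 1 &
  forall y, 0 <= y.2 ->
    T (fun z => 1 * geom s s^-1 z + K * geom s 1 z) y
    <= k * (1 * geom s s^-1 y + K * geom s 1 y)].
Proof.
have [rho20 [rho2r rrho1]] := r_bounds.
have r0 := lt_trans rho20 rho2r; have rho10 := lt_trans r0 rrho1.
pose s := (rho1 + 1) / 2.
have s1 : s < 1 by rewrite /s; move: rho1_lt1; lra.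
have rho1s : rho1 < s by rewrite /s; move: rho1_lt1; lra.
have s0 := lt_trans rho10 rho1s.
have sn0 : s != 0 by rewrite gt_eqF.
(* [f] is the eigenvalue of [s ^ (y.1 - y.2)] above the axis and [t] that of [s ^ y.1], axis
   included; they are below 1 because [r < s < 1] and [rho1 < s < 1] respectively. *)
set f := l1 / s + m1 * s + l2 / s + m2 * s.
set t := l1 / s + m1 * s + l2 + m2.
have f1 : f < 1.
  have -> : f = 1 - (1 - s) * (m1 + m2 - (l1 + l2) / s).
    by rewrite -[X in X - (1 - _) * _]sum1 /f; field.
  rewrite ltrBlDr ltrDl mulr_gt0 ?subr_gt0// ltr_pdivrMr// mulrC -ltr_pdivrMr ?addr_gt0//.
  exact: lt_trans rho1s.
have t1 : t < 1.
  have -> : t = 1 - (1 - s) * (m1 - l1 / s).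
    by rewrite -[X in X - (1 - _) * _]sum1 /t; field.
  by rewrite ltrBlDr ltrDl mulr_gt0 ?subr_gt0// ltr_pdivrMr// mulrC -ltr_pdivrMr.
have f0 : 0 < f by rewrite /f !addr_gt0// mulr_gt0// invr_gt0.
(* On the axis the first term gains [m2 * (1 - s)]. With this [K], half of the gap [1 - t] of the
   second term absorbs it, and the other half still contracts. *)
pose K := m2 * (1 - s) / ((1 - t) / 2).
have K0 : 0 < K by rewrite divr_gt0 ?mulr_gt0 ?subr_gt0.
have KE : m2 * (1 - s) = K * ((1 - t) / 2).
  by rewrite /K mulfVK// mulf_neq0// gt_eqF// subr_gt0.
exists s, K, (Num.max f ((1 + t) / 2)); split => //.
- by rewrite le_max ltW.
- by rewrite gt_max f1/=; lra.
move=> y y0; rewrite transitionD !transition_geom ?invr_eq0 ?oner_neq0//.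
rewrite invr1 if_same invrK !mulr1 -/t.
have G1 := geom_gt0 s s^-1 y s0; rewrite invr_gt0 in G1; have {}G1 := G1 s0.
have G2 := geom_gt0 s 1 y s0 ltr01.
set k := Num.max _ _.
have fk : f <= k by rewrite le_max lexx.
have tk : (1 + t) / 2 <= k by rewrite le_max lexx orbT.
have H1 : f * geom s s^-1 y <= k * geom s s^-1 y by rewrite ler_pM2r.
have H2 : K * ((1 + t) / 2 * geom s 1 y) <= K * (k * geom s 1 y).
  by rewrite ler_pM2l// ler_pM2r.
have H3 : K * (t * geom s 1 y) <= K * ((1 + t) / 2 * geom s 1 y).
  by rewrite ler_pM2l// ler_pM2r//; lra.
case: eqP => [e|_]; last by rewrite -/f; lra.
have E : geom s s^-1 y = geom s 1 y by rewrite /geom e !expr0z.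
have -> : l1 / s + m1 * s + l2 / s + m2 * 1 = f + K * ((1 - t) / 2).
  by rewrite -KE /f; ring.
rewrite E in H1 *; lra.
Qed.

(* [p] is the supremum of the [U n y], that is, the hitting probability. *)
Lemma hit_bounds : exists c1 M, [/\ 0 < c1, 0 < M &
  forall y p, B y -> (forall n, U n y <= p) ->
    (forall q, (forall n, U n y <= q) -> p <= q) ->
    [/\ 0 < p, p <= 2 * h_r r rho2 y + c1 * h_rho1 rho1 y &
     2 * h_r r rho2 y + c1 * h_rho1 rho1 y <= M * p]].
Proof.
have [rho20 [rho2r rrho1]] := r_bounds.
have r0 := lt_trans rho20 rho2r; have rho10 := lt_trans r0 rrho1.
have [c1 c10 hB] := h_bounds.
have [s [K [k [rho1s K0 k0 k1 gT]]]] := contracting_majorant.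
have s0 := lt_trans rho10 rho1s.
pose h y := 2 * h_r r rho2 y + c1 * h_rho1 rho1 y.
pose g y := 1 * geom s s^-1 y + K * geom s 1 y.
have hT z : B z -> T h z = h z.
  by move=> [z0 _]; rewrite transitionD transition_h_r// transition_h_rho1.
have hpos z : B z -> 0 < h z.
  by move=> /hB/andP[+ _]; apply: lt_le_trans; rewrite geom_gt0 ?invr_gt0.
have c0 : 0 < 2 + c1 by rewrite addr_gt0.
have hM z : B z -> h z <= 2 + c1.
  move=> Bz; have /andP[_ /le_trans] := hB z Bz; apply.
  have [m [n ->]] := B_diag _ Bz; rewrite geom_antidiag ?gt_eqF//.
  by rewrite ler_piMr ?(ltW c0)// exprn_ile1 ?ltW.
have h1 z : bdB z -> 1 <= h z.
  case: z => z1 z2 [z20 /= ->]; have /hB/andP[+ _] : B (z2, z2) by split => //=.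
  by apply: le_trans; rewrite /geom /= -expfV mulfV// expfz_neq0// gt_eqF.
have hg z : B z -> h z <= (2 + c1) * g z.
  move=> Bz; have /andP[_ /le_trans] := hB z Bz; apply.
  rewrite ler_pM2l// /g; have := geom_gt0 s 1 z s0 ltr01.
  have [m [n ->]] := B_diag _ Bz; rewrite !geom_antidiag ?gt_eqF// => G.
  have : 0 < K * geom s 1 (n%:Z + m%:Z, n%:Z) by rewrite mulr_gt0.
  have : rho1 ^+ m <= s ^+ m by rewrite lerXn2r ?nnegrE ?ltW.
  lra.
have g0 z : 0 < g z by rewrite /g mul1r addr_gt0 ?(mulr_gt0 K0)// geom_gt0 ?invr_gt0.
have upper y p : B y -> (forall q, (forall n, U n y <= q) -> p <= q) -> p <= h y.
  by move=> By; apply=> n; apply: hit_within_le => // z /hpos /ltW.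
have lower y n : B y -> h y <= (2 + c1) * U n y + (2 + c1) * k ^+ n * g y.
  by move=> By; apply: le_hit_within => //; [exact: ltW|exact: ltW|
    move=> z _; exact: ltW|move=> z [z0 _]; exact: gT].
exists c1, (2 + c1); split=> // y p By Up pU.
have hp : h y <= (2 + c1) * p.
  (* For fixed [y] the error term of [lower] tends to 0 as [n] grows. *)
  apply/ler_addgt0Pr => e e0.
  have [n kn] := exprn_small k (e / ((2 + c1) * g y)) k0 k1
    (divr_gt0 e0 (mulr_gt0 c0 (g0 y))).
  apply: le_trans (lower y n By) _; rewrite lerD ?ler_pM2l//.
  by move: kn; rewrite ler_pdivlMr ?mulr_gt0// mulrCA mulrA.
split; [|exact: upper|exact: hp].
(* Positivity of [p] is forced by [0 < h y <= (2 + c1) * p]. *)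
by have := lt_le_trans (hpos _ By) hp; rewrite pmulr_rgt0.
Qed.

End Transition.

(** * Hitting events of the walk and their probabilities *)

(** [walk] peels off the last increment, whereas first-step analysis needs the first one peeled off
    and the increments shifted. *)
Lemma walkSr (x : nat -> int * int) y n :
  walk x y n.+1 = walk (fun i => x i.+1) (step y (x 0%N)) n.
Proof. by elim: n => [//|n IH]; rewrite [LHS]/= -/(walk x y n.+1) IH. Qed.

(** The walk is started afresh at time [m], so the event depends only on increments from [J m] on;
    the union is over countably many values, which gives measurability. *)
Fixpoint hit_event {T : Type} (J : nat -> T -> int * int) (m n : nat) (y : int * int) : set T :=
  if (0 <= y.2) && (y.1 == y.2) then setT else
  if n is k.+1 then
    \bigcup_j (J m @^-1` [set j] `&` hit_event J m.+1 k (step y j))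
  else set0.

Lemma hit_event_bdB {T : Type} (J : nat -> T -> int * int) m n y :
  bdB y -> hit_event J m n y = setT.
Proof. by move/bdBP => h; case: n => [|n] /=; rewrite h. Qed.

Lemma hit_eventS {T : Type} (J : nat -> T -> int * int) m n y : ~ bdB y ->
  hit_event J m n.+1 y =
  \bigcup_j (J m @^-1` [set j] `&` hit_event J m.+1 n (step y j)).
Proof. by move/bdBP/negbTE => /= ->. Qed.

Lemma hit_eventE {T : Type} (J : nat -> T -> int * int) m n y :
  hit_event J m n y =
  [set w | exists2 k, (k <= n)%N & bdB (walk (fun i => J (m + i)%N w) y k)].
Proof.
elim: n m y => [|n IH] m y; have [yB|yB] := pselect (bdB y).
- by rewrite hit_event_bdB//; apply/esym/seteqP; split=> // w _; exists 0%N.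
- rewrite /=; move/bdBP/negbTE : (yB) => ->.
  by apply/seteqP; split=> // w [[|//] _].
- by rewrite hit_event_bdB//; apply/esym/seteqP; split=> // w _; exists 0%N.
rewrite hit_eventS//; apply/seteqP; split=> w.
  move=> [j _ [<-]]; rewrite IH => -[k kn h]; exists k.+1 => //.
  rewrite walkSr addn0; congr bdB : h; congr walk.
  by apply/funext => i; rewrite addnS.
move=> [[|k] kn] //; rewrite walkSr addn0 => h.
exists (J m w) => //; split => //; rewrite IH; exists k => //.
congr bdB : h; congr walk; by apply/funext => i; rewrite addnS.
Qed.

Section Probability.
Context {R : realType} {d : measure_display} {T : measurableType d}
  (P : probability T R) (l1 l2 m1 m2 : R) (J : nat -> T -> int * int).
Hypotheses (sum1 : l1 + l2 + m1 + m2 = 1) (iidJ : iid_increments P l1 l2 m1 m2 J).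

Local Notation U := (hit_within l1 l2 m1 m2).

Lemma measurable_hit_event m n y : measurable (hit_event J m n y).
Proof.
have [mJ _ _] := iidJ.
elim: n m y => [|n IH] m y; have [yB|yB] := pselect (bdB y).
- by rewrite hit_event_bdB.
- by rewrite /=; case: ifP.
- by rewrite hit_event_bdB.
rewrite hit_eventS//; apply: countable_bigcupT_measurable => // j.
by apply: measurableI.
Qed.

(** The four values have total mass 1, so the event that [J k] takes any other value is null. *)
Lemma increment_split k (S : set T) : measurable S ->
  P S = (P (S `&` J k @^-1` [set (-1, 0)%R]) + P (S `&` J k @^-1` [set (1, 0)%R]) +
         P (S `&` J k @^-1` [set (0, 1)%R]) + P (S `&` J k @^-1` [set (0, -1)%R]))%E.
Proof.
move=> mS; have [mJ _ lJ] := iidJ; have [e1 e2 e3 e4] := lJ k.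
set X1 := J k @^-1` _; set X2 := J k @^-1` [set (1, 0)].
set X3 := J k @^-1` [set (0, 1)]; set X4 := J k @^-1` [set (0, -1)].
have mX1 : measurable X1 by exact: mJ.
have mX2 : measurable X2 by exact: mJ.
have mX3 : measurable X3 by exact: mJ.
have mX4 : measurable X4 by exact: mJ.
have add (S' : set T) : measurable S' ->
    P (S' `&` (X1 `|` X2 `|` X3 `|` X4)) =
    (P (S' `&` X1) + P (S' `&` X2) + P (S' `&` X3) + P (S' `&` X4))%E.
  move=> mS'; rewrite !setIUr !measureU//; do ?[by apply: measurableI
    | by apply: measurableU; do ?[apply: measurableU]; apply: measurableI];
  apply/seteqP; split=> // w.
  - by move=> [[_ +] [_]]; rewrite /X1 /X2 /X3 /X4 /= => ->.
  - by move=> [[[_ +]|[_ +]] [_]]; rewrite /X1 /X2 /X3 /X4 /= => ->.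
  - by move=> [[[[_ +]|[_ +]]|[_ +]] [_]]; rewrite /X1 /X2 /X3 /X4 /= => ->.
rewrite -add//.
have mD : measurable (X1 `|` X2 `|` X3 `|` X4) by do ?[apply: measurableU].
have PD : P (X1 `|` X2 `|` X3 `|` X4) = 1%E.
  rewrite -[X in P X]setTI add// !setTI.
  transitivity (l1%:E + m1%:E + l2%:E + m2%:E)%E.
    by congr (_ + _ + _ + _)%E.
  by rewrite -!EFinD; congr EFin; rewrite -sum1; ring.
rewrite [LHS](measureDI P mS mD) setDE.
rewrite (@subset_measure0 _ _ _ P _ (~` (X1 `|` X2 `|` X3 `|` X4))) ?add0e//.
- exact: measurableI (measurableC _).
- exact: measurableC.
- by rewrite [LHS](probability_setC P mD) PD subee.
Qed.

(* The event over [F] describes the increments before time [m]: in the induction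
   on [n], the value of [J m] moves from the hitting event into [F]. *)
Lemma P_hit_event_cond n m (F : {fset nat}) (A : nat -> set (int * int)) y :
  (forall i, i \in F -> (i < m)%N) ->
  P (\bigcap_(k in [set` F]) (J k @^-1` A k) `&` hit_event J m n y) =
  (P (\bigcap_(k in [set` F]) (J k @^-1` A k)) * (U n y)%:E)%E.
Proof.
have [mJ iJ lJ] := iidJ.
elim: n m F A y => [|n IH] m F A y Fm; have [yB|yB] := pselect (bdB y).
- by rewrite hit_event_bdB// hit_within_bdB// setIT mule1.
- rewrite /=; move/bdBP/negbTE : (yB) => ->.
  by rewrite setI0 measure0 mule0.
- by rewrite hit_event_bdB// hit_within_bdB// setIT mule1.
have mF : m \notin F by apply/negP => /Fm; rewrite ltnn.
have mC (G : {fset nat}) B : measurable (\bigcap_(k in [set` G]) (J k @^-1` B k)).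
  exact: bigcap_measurableType.
(* Fixing [J m] at [j] adds one constraint at an index outside [F], so independence splits off its
   probability. *)
pose A' j k := if k == m then [set j] else A k.
have A'E j : \bigcap_(k in [set` (m |` F)%fset]) (J k @^-1` A' j k) =
    \bigcap_(k in [set` F]) (J k @^-1` A k) `&` J m @^-1` [set j].
  rewrite bigcap_fsetU1 setIC /A' eqxx; congr (_ `&` _).
  apply: eq_bigcapr => k kF; case: eqP => // km.
  by move: kF mF; rewrite /= km => ->.
have PA' j p : P (J m @^-1` [set j]) = p%:E ->
    P (\bigcap_(k in [set` F]) (J k @^-1` A k) `&` J m @^-1` [set j]) =
    (p%:E * P (\bigcap_(k in [set` F]) (J k @^-1` A k)))%E.
  move=> jp; rewrite -A'E !iJ big_fsetU1//= {1}/A' eqxx jp; congr (_ * _)%E.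
  apply: eq_big_seq => k kF; rewrite /A'; case: eqP => // km.
  by move: kF mF; rewrite /= km => ->.
have Fm' i : i \in (m |` F)%fset -> (i < m.+1)%N.
  by rewrite !inE => /orP[/eqP->//|/Fm/ltnW].
(* Once [J m = j] is imposed, the union in [hit_event] collapses to its [j] term, to which the
   induction hypothesis applies with the enlarged index set. *)
have part j p : P (J m @^-1` [set j]) = p%:E ->
    P (\bigcap_(k in [set` F]) (J k @^-1` A k) `&` hit_event J m n.+1 y `&`
       J m @^-1` [set j]) =
    (P (\bigcap_(k in [set` F]) (J k @^-1` A k)) * (p * U n (step y j))%:E)%E.
  move=> jp; rewrite EFinM muleA [X in (X * _)%E]muleC.
  rewrite -(PA' _ _ jp) -A'E -(IH _ _ _ _ Fm') A'E hit_eventS//.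
  congr (P _); apply/seteqP; split=> w /=.
    by move=> [[Cw [i _ [<- ?]]] <-].
  by move=> [[Cw jw] ?]; split=> //; split=> //; exists j.
have [e1 e2 e3 e4] := lJ m.
rewrite (increment_split m); last exact: measurableI (measurable_hit_event _ _ _).
rewrite (part _ _ e1) (part _ _ e2) (part _ _ e3) (part _ _ e4) hit_withinS//.
have : P (\bigcap_(k in [set` F]) (J k @^-1` A k)) \is a fin_num.
  exact: fin_num_measure.
move=> /fineK <-; rewrite -!EFinM -!EFinD; congr EFin.
by rewrite /transition; ring.
Qed.

Lemma P_hit_event n y : P (hit_event J 0 n y) = (U n y)%:E.
Proof.
have := P_hit_event_cond n 0 fset0 (fun=> setT) y (fun i => ltac:(by rewrite inE)).
by rewrite set_fset0 bigcap_set0 setTI probability_setT mul1e.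
Qed.

Lemma tau_finite y :
  [set w | (tau R J y w < +oo)%E] = \bigcup_n hit_event J 0 n y :> set T.
Proof.
apply/seteqP; split=> w.
  move=> /ereal_inf_lt[_ [k kB <-] _]; exists k => //.
  by rewrite hit_eventE; exists k.
move=> [n _]; rewrite hit_eventE => -[k _ kB].
apply: le_lt_trans (ltry k%:R).
by apply: ereal_inf_lbound; exists k.
Qed.

(** Continuity of [P] from below along the increasing events [hit_event J 0 n y], whose union is
    finiteness of [tau]. *)
Lemma hit_prob_sup y :
  (forall n, U n y <= hit_prob P J y) /\
  (forall q, (forall n, U n y <= q) -> hit_prob P J y <= q).
Proof.
have mE : measurable [set w | (tau R J y w < +oo)%E].
  by rewrite tau_finite; apply: bigcup_measurable => n _; exact: measurable_hit_event.
have hitE : (hit_prob P J y)%:E = P [set w | (tau R J y w < +oo)%E].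
  by rewrite /hit_prob fineK ?fin_num_measure.
split=> [n|q Uq].
  rewrite -lee_fin hitE -P_hit_event le_measure ?inE//.
    exact: measurable_hit_event.
  by rewrite tau_finite; move=> w hw; exists n.
rewrite -lee_fin hitE tau_finite.
have : P \o (fun n => hit_event J 0 n y) @ \oo --> P (\bigcup_n hit_event J 0 n y).
  apply: nondecreasing_cvg_mu; first by move=> n; exact: measurable_hit_event.
    by rewrite -tau_finite.
  move=> a b ab; apply/subsetPset => w; rewrite !hit_eventE => -[k ka kB].
  by exists k => //; exact: leq_trans ab.
move=> c; rewrite -(cvg_lim _ c)//; apply: lime_le; first by apply/cvg_ex; eexists; exact: c.
by apply: nearW => n /=; rewrite P_hit_event lee_fin.
Qed.

End Probability.

Theorem proposition7p3 (R : realType) (lambda1 lambda2 mu1 mu2 : R)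
  (d : measure_display) (T : measurableType d) (P : probability T R)
  (J : nat -> T -> int * int) :
  let rho1 := lambda1 / mu1 in
  let rho2 := lambda2 / mu2 in
  let r := (lambda1 + lambda2) / (mu1 + mu2) in
  0 < lambda1 -> 0 < lambda2 -> 0 < mu1 -> 0 < mu2 ->
  lambda1 + lambda2 + mu1 + mu2 = 1 ->
  rho1 < 1 -> rho2 < 1 ->
  rho2 <= r -> r <= rho1 ->
  rho1 <> rho2 ->
  r ^+ 2 / rho2 < 1 ->
  iid_increments P lambda1 lambda2 mu1 mu2 J ->
  exists c0 c1 C8 : R,
    let ha0 y := c0 * h_r r rho2 y + c1 * h_rho1 rho1 y in
    [/\ 0 < c0, 0 < c1, 0 < C8,
        forall y, B y ->
          hit_prob P J y <= ha0 y /\ ha0 y <= C8 * hit_prob P J y &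
        exists M : R, forall y, B y ->
          0 < hit_prob P J y /\
          `|ha0 y - hit_prob P J y| / hit_prob P J y <= M].
Proof.
move=> rho1 rho2 r l1_gt0 l2_gt0 m1_gt0 m2_gt0 sum1 rho1_lt1 _ rho2r rrho1 rho12 qr iidJ.
have rho21 : rho2 < rho1.
  by rewrite lt_neqAle (le_trans rho2r rrho1) andbT; apply/eqP => /esym.
have [c1 [M [c10 M0 H]]] :=
  hit_bounds _ _ _ _ l1_gt0 l2_gt0 m1_gt0 m2_gt0 sum1 rho21 rho1_lt1 qr.
exists 2, c1, M => ha0.
have {}H y : B y -> [/\ 0 < hit_prob P J y, hit_prob P J y <= ha0 y &
    ha0 y <= M * hit_prob P J y].
  move=> By; have [h1 h2] := hit_prob_sup P _ _ _ _ _ sum1 iidJ y.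
  exact: (H y _ By h1 h2).
split=> //; first by move=> y /H[].
exists M => y /H[p0 ph hM]; split=> //.
(* As [hit_prob P J y <= ha0 y], the error is [ha0 y - hit_prob P J y], which is at most [ha0 y]. *)
rewrite ler_pdivrMr// ger0_norm ?subr_ge0//.
by apply: le_trans hM; rewrite gerBl ltW.
Qed.
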